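(* Let $H\in C^2(\mathbb R^d\times\mathbb R^d;\mathbb R)$, $H=H(p,x)$, be $\mathbb Z^d$-periodic in $x$, with $D^2_{pp}H>0$ and $\lim_{|p|\to+\infty}|p|^{-1}H(p,x)=+\infty$ uniformly in $x$. Let $\zeta:\mathbb R^d\to\mathbb R$ be nonnegative, Lipschitz continuous and compactly supported, and for $R\in\mathbb N$ set $\zeta_R(x)=\sum_{k\in\mathbb Z^d}\zeta(x-Rk)$ and $H_R(p,x)=H(p,x)-\zeta_R(x)$, with effective constants $\overline H$ and $\overline H_R$ for $H$ and $H_R$. Then there exists a constant $C>0$ depending only on $\zeta$ such that $$0\le\overline H-\overline H_R\le CR^{-d}\qquad\text{for all }R\in\mathbb N .$$
   Context: Hamilton-Jacobi equations are understood in the viscosity sense; $\mathbb N$ is the set of positive integers. $\overline H$ is the unique constant for which $H(D\chi,x)=\overline H$ in $\mathbb R^d$ has a continuous $\mathbb Z^d$-periodic solution $\chi$. $\overline H_R$ is the unique constant for which $H(D\chi_R,x)=\zeta_R(x)+\overline H_R$ in $\mathbb R^d$ has a continuous $R\mathbb Z^d$-periodic solution $\chi_R$. *)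

(* Defs.v *)
From HB Require Import structures.
From mathcomp Require Import all_boot all_order all_algebra.
From mathcomp Require Import all_classical all_reals all_analysis.

Set Implicit Arguments.
Unset Strict Implicit.
Unset Printing Implicit Defensive.

Import Order.TTheory GRing.Theory Num.Theory.
Import numFieldNormedType.Exports.

Local Open Scope classical_set_scope.
Local Open Scope ring_scope.

(* R^d is 'rV[R]_d with the library's norm `|x| = max_i `|x 0 i|. The norm is
   used below only for superlinear growth and Lipschitz continuity, neither of
   which changes when the Euclidean norm is used instead. *)

Section Regularity.
Context {R : realType} {V : normedModType R}.
Implicit Types f : V -> R.

(* For finite-dimensional V, continuity of all directional derivatives is
   continuity of the differential. *)
Definition C1 f : Prop :=
  (forall x, differentiable f x) /\ (forall v, continuous ('D_v f)).

Definition C2 f : Prop := C1 f /\ (forall v, C1 ('D_v f)).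

Definition compactly_supported f : Prop := compact (closure [set x | f x != 0]).

End Regularity.

Section HamiltonJacobi.
Context {R : realType} {d : nat}.
Local Notation E := 'rV[R]_d.

Definition grad (f : E -> R) (x : E) : E := \row_i 'D_(delta_mx 0 i) f x.

Definition hessian (f : E -> R) (x : E) : 'M[R]_d :=
  \matrix_(i, j) 'D_(delta_mx 0 i) ('D_(delta_mx 0 j) f) x.

(* Symmetry is not required: it is automatic for the Hessian of a C2 function. *)
Definition positive_definite (A : 'M[R]_d) : Prop :=
  forall v : E, v != 0 -> 0 < (v *m A *m v^T) 0 0.

Definition lattice_point (k : 'rV[int]_d) : E := map_mx intr k.

(* Invariance under translations by N Z^d. *)
Definition lattice_periodic (N : nat) (f : E -> R) : Prop :=
  forall (k : 'rV[int]_d) (x : E), f (x + N%:R *: lattice_point k) = f x.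

Definition superlinear (H : E -> E -> R) : Prop :=
  forall M : R, exists r : R, 0 < r /\
    forall p x : E, r <= `|p| -> M <= `|p|^-1 * H p x.

(* Viscosity sub/supersolutions of F (Du, x) = 0 in R^d. *)
Definition viscosity_subsolution (F : E -> E -> R) (u : E -> R) : Prop :=
  forall (phi : E -> R) (x0 : E), C1 phi ->
    (\forall x \near x0, u x - phi x <= u x0 - phi x0) ->
    F (grad phi x0) x0 <= 0.

Definition viscosity_supersolution (F : E -> E -> R) (u : E -> R) : Prop :=
  forall (phi : E -> R) (x0 : E), C1 phi ->
    (\forall x \near x0, u x0 - phi x0 <= u x - phi x) ->
    0 <= F (grad phi x0) x0.

Definition viscosity_solution (F : E -> E -> R) (u : E -> R) : Prop :=
  viscosity_subsolution F u /\ viscosity_supersolution F u.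

(* c is an effective constant of G for the period lattice N Z^d: the cell
   problem G (D chi, x) = c has a continuous periodic solution. At most one c
   has this property for the Hamiltonians considered here; uniqueness is not
   made part of the definition. *)
Definition effective_constant (G : E -> E -> R) (N : nat) (c : R) : Prop :=
  exists chi : E -> R,
    [/\ continuous chi, lattice_periodic N chi &
        viscosity_solution (fun p x => G p x - c) chi].

(* \sum_(k \in A) sums over the k in A at which the summand is nonzero, and is
   0 when there are infinitely many; for compactly supported zeta and N > 0
   there are only finitely many at each x. *)
Definition periodized (zeta : E -> R) (N : nat) (x : E) : R :=
  \sum_(k \in [set: 'rV[int]_d]) zeta (x - N%:R *: lattice_point k).

Definition perturbed (H : E -> E -> R) (zeta : E -> R) (N : nat) (p x : E) : R :=
  H p x - periodized zeta N x.

End HamiltonJacobi.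

(* Main.v *)
(** By periodicity the [N^d] integer translates [chi_N(x - k)], [k] in
    [{0,...,N-1}^d], solve the cell problem of [H] with right-hand sides
    [HbarN + zeta_N(x - k)], and the average of these right-hand sides is
    [HbarN + N^-d zeta_1(x)].  Since [H] is convex in [p], the average of the
    translates should be a subsolution with that averaged right-hand side, and
    comparison with [chi] gives [Hbar <= HbarN + N^-d sup zeta_1].

    Averaging and comparison are done in one doubling of variables, with one
    point [y - k + h_k] per translate and the penalty [a |h_k|^2]: at a maximum
    [(y, h)] the subsolution tests have gradients [p_k = 2 a h_k], the
    supersolution test has gradient the mean of the [p_k], and Jensen's
    inequality for [H(., y)] closes the argument without differentiating any
    solution almost everywhere.  The case of a single translate gives the lower
    bound. *)
Require Import Defs.
From HB Require Import structures.
From mathcomp Require Import all_boot all_order all_algebra.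
From mathcomp Require Import all_classical all_reals all_analysis.
From mathcomp Require Import ring lra zify.

Import Order.TTheory GRing.Theory Num.Theory.
Import numFieldNormedType.Exports.

Local Open Scope classical_set_scope.
Local Open Scope ring_scope.

(** * Directional derivatives and the tangent inequality *)

Section Derivatives.
Context {R : realType}.

Lemma derive_sum_comb {V : normedModType R} n (f : V -> R) (a : 'I_n -> R)
    (e : 'I_n -> V) x : differentiable f x ->
  'D_(\sum_i a i *: e i) f x = \sum_i a i * 'D_(e i) f x.
Proof.
move=> df; rewrite deriveE// linear_sum; apply: eq_bigr => i _.
by rewrite linearZ deriveE.
Qed.

Lemma derive_fst {V W U : normedModType R} (G : V * W -> U) v p x :
  'D_v (fun q => G (q, x)) p = 'D_(v, 0) G (p, x).
Proof.
rewrite /derive.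
suff -> : (fun h : R => h^-1 *: ((G \o shift (p, x)) (h *: (v, 0)) - G (p, x))) =
    (fun h => h^-1 *: (((fun q => G (q, x)) \o shift p) (h *: v) - G (p, x))).
  by [].
apply/funext => h /=; congr (_ *: (G _ - _)).
by congr (_, _); rewrite /= scaler0 add0r.
Qed.

Lemma differentiable_fst {V W U : normedModType R} (G : V * W -> U)
    (p : V) (x : W) :
  differentiable G (p, x) -> differentiable (fun q => G (q, x)) p.
Proof.
move=> dG.
by apply: (@differentiable_comp _ _ (V * W)%type _ (fun q : V => (q, x)) G).
Qed.

Lemma is_derive_line {V : normedModType R} (f : V -> R) (p v : V) (t : R) :
  differentiable f (p + t *: v) ->
  is_derive t 1 (fun s => f (p + s *: v)) ('D_v f (p + t *: v)).
Proof.
move=> df.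
have E : (fun h : R => h^-1 *: (((fun s => f (p + s *: v)) \o shift t) (h *: 1)
      - f (p + t *: v))) =
    (fun h => h^-1 *: ((f \o shift (p + t *: v)) (h *: v) - f (p + t *: v))).
  apply/funext => h /=; congr (_ *: (f _ - _)).
  by rewrite /shift/= [h *: 1]mulr1 scalerDl addrCA addrA.
apply: DeriveDef; last by rewrite /derive E.
by rewrite /derivable E; exact: diff_derivable.
Qed.

(** The mean value theorem on the segment gives the increment as ['D_v f] at an intermediate point;
    applied again, to ['D_v f], it shows that this value is at least ['D_v f p]. *)
Lemma convex_ge_tangent {V : normedModType R} (f : V -> R) (p v : V) :
  (forall q, differentiable f q) -> (forall q, differentiable ('D_v f) q) ->
  (forall q, 0 <= 'D_v ('D_v f) q) ->
  f p + 'D_v f p <= f (p + v).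
Proof.
move=> df ddf ge0.
pose g (t : R) := f (p + t *: v).
have dg (t : R) : is_derive t 1 g ('D_v f (p + t *: v)) by exact: is_derive_line.
have cg : continuous g.
  by move=> t; apply/differentiable_continuous/derivable1_diffP; case: (dg t).
have [|c /[!in_itv]/= /andP[c0 c1]] :=
    MVT (ltr01 : (0 : R) < 1) (fun t _ => dg t).
  exact: continuous_subspaceT.
rewrite /g scale0r addr0 scale1r subr0 mulr1 => E.
suff : 'D_v f p <= 'D_v f (p + c *: v) by move: E; lra.
pose g1 (t : R) := 'D_v f (p + t *: v).
have dg1 (t : R) : is_derive t 1 g1 ('D_v ('D_v f) (p + t *: v)).
  exact: is_derive_line.
have cg1 : continuous g1.
  by move=> t; apply/differentiable_continuous/derivable1_diffP; case: (dg1 t).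
have [|e _] := MVT c0 (fun t _ => dg1 t); first exact: continuous_subspaceT.
rewrite /g1 scale0r addr0 subr0 => E1.
by rewrite -subr_ge0 E1 mulr_ge0// ltW.
Qed.

End Derivatives.

(** * From a positive definite Hessian to Jensen's inequality *)

Section Convexity.
Context {R : realType} {d : nat}.
Local Notation E := 'rV[R]_d.

Lemma derive_hessian (f : E -> R) (v p : E) :
  (forall q, differentiable f q) ->
  (forall w q, differentiable ('D_w f) q) ->
  'D_v ('D_v f) p = (v *m hessian f p *m v^T) 0 0.
Proof.
move=> df ddf.
have Dv g q : differentiable g q ->
    'D_v g q = \sum_i v 0 i * 'D_(delta_mx 0 i) g q.
  by move=> dg; rewrite [in LHS](row_sum_delta v) derive_sum_comb.
have -> : 'D_v f = \sum_j v 0 j *: 'D_(delta_mx 0 j) f.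
  apply/funext => q; rewrite Dv//.
  by rewrite fct_sumE.
rewrite derive_sum; last first.
  by move=> j; apply/derivableZ/diff_derivable/ddf.
rewrite !mxE; apply: eq_bigr => j _.
rewrite deriveZ; last exact/diff_derivable/ddf.
rewrite Dv//.
rewrite !mxE [LHS]mulrC; congr (_ * _); apply: eq_bigr => i _.
by rewrite !mxE.
Qed.

(** Summing the tangent inequalities at the mean [q] suffices: the first-order terms cancel because
    the vectors [p i - q] sum to zero. *)
Lemma jensen_hamiltonian (H : E -> E -> R) (x : E) (I : finType) (p : I -> E) :
  C2 (fun z : E * E => H z.1 z.2) ->
  (forall q, positive_definite (hessian (fun q => H q x) q)) ->
  (0 < #|I|)%N ->
  #|I|%:R * H (#|I|%:R^-1 *: \sum_i p i) x <= \sum_i H (p i) x.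
Proof.
move=> [[dH _] ddH] pd I0; set q := _ *: _.
pose f q := H q x.
have df q' : differentiable f q'.
  exact: (differentiable_fst _ _ _ (dH (q', x))).
have Df v : 'D_v f = fun q' => 'D_(v, 0) (fun z : E * E => H z.1 z.2) (q', x).
  by apply/funext => q'; rewrite -derive_fst.
have ddf v q' : differentiable ('D_v f) q'.
  by rewrite Df; exact: (differentiable_fst _ _ _ ((ddH (v, 0)).1 (q', x))).
have tangent i : f q + 'D_(p i - q) f q <= f (p i).
  have -> : f (p i) = f (q + (p i - q)) by rewrite addrC subrK.
  apply: convex_ge_tangent => // q'; rewrite derive_hessian//.
  have [->|v0] := eqVneq (p i - q) 0; first by rewrite !mul0mx mxE.
  exact/ltW/pd.
apply: (@le_trans _ _ (\sum_i (f q + 'D_(p i - q) f q))); last exact: ler_sum.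
rewrite big_split/= sumr_const mulr_natl lerDl.
under eq_bigr do rewrite deriveE//.
rewrite -linear_sum sumrB sumr_const -scaler_nat scalerA mulfV.
  by rewrite scale1r subrr linear0.
by rewrite pnatr_eq0 -lt0n.
Qed.

End Convexity.

(** * Quadratic penalties as smooth test functions *)

Section Quadratic.
Context {R : realType} {d : nat}.
Local Notation E := 'rV[R]_d.

(** The squared Euclidean norm, which is smooth, whereas the max norm in general is not. *)
Definition sqnorm (x : E) : R := \sum_i x 0 i ^+ 2.

Lemma sqnorm0 : sqnorm 0 = 0.
Proof. by rewrite /sqnorm big1// => i _; rewrite mxE expr0n. Qed.

Lemma sqnorm_ge_norm (x : E) : `|x| ^+ 2 <= sqnorm x.
Proof.
have [->|x0] := eqVneq x 0; first by rewrite normr0 expr0n sqnorm0.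
have /mx_norm_neq0[[i j]/= nx] : mx_norm x != 0.
  by rewrite -[mx_norm x]/(`|x|) normr_eq0.
rewrite -[`|x|]/(mx_norm x) nx !ord1 -normrX ger0_norm ?sqr_ge0//.
by rewrite /sqnorm (bigD1 j)//= lerDl sumr_ge0// => k _; rewrite sqr_ge0.
Qed.

Lemma continuous_sqnorm : continuous sqnorm.
Proof.
apply: continuous_big => [|i _ x]; first exact: add_continuous.
apply: (@continuous_comp _ _ _ (fun y : E => y 0 i) (fun t => t ^+ 2)).
  exact: coord_continuous.
exact: exprn_continuous.
Qed.

Lemma is_derive_coord (i : 'I_d) (x v : E) :
  is_derive x v (fun y : E => y 0 i) (v 0 i).
Proof.
apply: DeriveDef; first exact/diff_derivable/differentiable_coord.
have /derive_mx : derivable (id : E -> E) x v by exact: derivable_id.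
by rewrite derive_id => /matrixP/(_ 0 i); rewrite mxE => ->.
Qed.

Definition paraboloid (a : R) (w x : E) : R := a * sqnorm (x - w).

Lemma paraboloidE a w : paraboloid a w =
  a *: \sum_i ((fun y : E => y 0 i) - cst (w 0 i)) ^+ 2.
Proof.
apply/funext => y; rewrite /paraboloid /sqnorm fctE; congr (_ * _).
by rewrite fct_sumE; apply: eq_bigr => i _; rewrite !mxE.
Qed.

Lemma differentiable_paraboloid a w x : differentiable (paraboloid a w) x.
Proof.
rewrite paraboloidE; apply/differentiableZ/differentiable_sum => i.
by apply/differentiableX/differentiableB => //; exact: differentiable_coord.
Qed.

Lemma derive_paraboloid a w x v :
  'D_v (paraboloid a w) x = \sum_i a *+ 2 * (x 0 i - w 0 i) * v 0 i.
Proof.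
rewrite paraboloidE.
have dc := is_derive_coord.
rewrite derive_val /= scaler_sumr; apply: eq_bigr => i _.
rewrite subr0 -[_ *: (_ *: _)]/(a * (_ * _)) !fctE /= /cst expr1 -mulr_natl.
by rewrite -mulr_natl; ring.
Qed.

Lemma C1_paraboloid a w : C1 (paraboloid a w).
Proof.
split=> [x|v]; first exact: differentiable_paraboloid.
rewrite (_ : 'D_v _ = fun x : E => \sum_i a *+ 2 * (x 0 i - w 0 i) * v 0 i).
  apply: continuous_big => [|i _ x]; first exact: add_continuous.
  apply: (@continuousM _ _ (fun y : E => a *+ 2 * (y 0 i - w 0 i)) (cst _)).
    apply: (@continuousM _ _ (cst _) (fun y : E => y 0 i - w 0 i)).
      exact: cst_continuous.
    apply: (@continuousB _ _ _ (fun y : E => y 0 i) (cst _)).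
      exact: coord_continuous.
    exact: cst_continuous.
  exact: cst_continuous.
by apply/funext => x; exact: derive_paraboloid.
Qed.

Lemma grad_paraboloid a w x : grad (paraboloid a w) x = (a *+ 2) *: (x - w).
Proof.
apply/rowP => i; rewrite !mxE derive_paraboloid (bigD1 i)//= big1.
  by rewrite !mxE !eqxx mulr1 addr0.
by move=> j /negPf ji; rewrite mxE ji andbF mulr0.
Qed.

(** The Huygens-Steiner identity. As a function of [y], the total penalty is one paraboloid centred
    at the barycenter plus a constant, which makes it a test function for the supersolution. *)
Lemma sum_sqnorm_barycenter (I : finType) (w : I -> E) (y : E) :
  (0 < #|I|)%N -> let m := #|I|%:R^-1 *: \sum_i w i in
  \sum_i sqnorm (w i - y) =
  #|I|%:R * sqnorm (y - m) + (\sum_i sqnorm (w i) - #|I|%:R * sqnorm m).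
Proof.
move=> I0 m.
have n0 : #|I|%:R != 0 :> R by rewrite pnatr_eq0 -lt0n.
rewrite /sqnorm [LHS]exchange_big [X in _ = _ + (X - _)]exchange_big/=.
rewrite !mulr_sumr -sumrB -big_split/=; apply: eq_bigr => j _.
set t := y 0 j.
have wm : \sum_i w i 0 j = #|I|%:R * m 0 j.
  by rewrite mxE summxE mulrA mulfV// mul1r.
have sq i : (w i - y) 0 j ^+ 2 = w i 0 j ^+ 2 + t ^+ 2 - 2 * t * w i 0 j.
  by rewrite !mxE -/t; ring.
rewrite (eq_bigr _ (fun i _ => sq i)) sumrB big_split/= sumr_const.
by rewrite -mulr_sumr wm -mulr_natl [(y - m) 0 j]mxE [(- m) 0 j]mxE -/t; ring.
Qed.

End Quadratic.

(** * Compact cubes and reduction modulo the lattice *)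

Section Cubes.
Context {R : realType} {d : nat}.
Local Notation E := 'rV[R]_d.

Definition cube (a b : R) : set E := [set x | forall i, `[a, b]%classic (x 0 i)].

Lemma compact_cube a b : compact (cube a b).
Proof.
by apply: (@rV_compact R d (fun=> `[a, b]%classic)) => i; exact: segment_compact.
Qed.

Lemma cubeP (r : R) (x : E) : 0 <= r -> (cube (- r) r x <-> `|x| <= r).
Proof.
move=> r0; rewrite -[`|x|]/(mx_norm x) mx_normrE; split=> [cx|xr i].
  apply/bigmax_leP; split=> // -[j i] _ /=; rewrite ord1 ler_norml.
  by have := cx i; rewrite /= in_itv.
rewrite /= in_itv/= -ler_norml; apply: le_trans xr.
exact: (le_bigmax _ (fun ij => `|x ij.1 ij.2|) (0, i)).
Qed.

Lemma lattice_reduction (N : nat) (x : E) : (0 < N)%N ->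
  exists k, cube 0 N%:R (x + N%:R *: lattice_point k).
Proof.
move=> N0; have N0' : 0 < N%:R :> R by rewrite ltr0n.
exists (\row_i - Num.floor (x 0 i / N%:R)) => i.
rewrite /= in_itv/= !mxE mulrNz.
have /andP[h1 h2] := floor_itv (x 0 i / N%:R).
move: h1 h2; rewrite ler_pdivlMr// ltr_pdivrMr// intrD mulrDl mul1r => h1 h2.
by apply/andP; split; move: h1 h2; rewrite mulrN [_ * N%:R]mulrC; lra.
Qed.

Lemma periodic_bounded (N : nat) (u : E -> R) : (0 < N)%N ->
  continuous u -> lattice_periodic N u -> exists B, forall x, `|u x| <= B.
Proof.
move=> N0 cu pu.
have /(compact_bounded)[M [_ MB]] : compact (u @` cube 0 N%:R).
  by apply: continuous_compact; [exact: continuous_subspaceT|exact: compact_cube].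
exists (M + 1) => x; have [k kx] := lattice_reduction N x N0.
rewrite -(pu k x); apply: (MB (M + 1)); first by rewrite ltrDl.
by exists (x + N%:R *: lattice_point k).
Qed.

End Cubes.

Lemma near_dist_lt {K : realType} {V : normedModType K} (z : V) (e : K) :
  0 < e -> \forall x \near z, `|z - x| < e.
Proof. by move=> e0; apply/nbhs_ballP; exists e => // x; rewrite -ball_normE. Qed.

(** * Doubling of variables with one displaced point per translate *)

Section Doubling.
Context {R : realType} {d : nat}.
Local Notation E := 'rV[R]_d.
Import ArrowAsProduct.

Definition doubled (I : finType) (k : I -> E) (a : R) (u v : E -> R) (y : E)
    (h : I -> E) : R :=
  \sum_i (u (y - k i + h i) - a * sqnorm (h i)) - #|I|%:R * v y.

(** Periodicity confines [y] to a period cube and the displacements are confined to the unit ball,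
    so the maximum is over a compact product. All variables form one family over [option I], with
    [None] carrying [y]. *)
Lemma doubled_max (I : finType) (k : I -> E) (a : R) (u v : E -> R) (N : nat) :
  (0 < N)%N -> continuous u -> continuous v ->
  lattice_periodic N u -> lattice_periodic N v ->
  exists y h, [/\ cube 0 N%:R y, forall i, `|h i| <= 1 &
    forall y' h', (forall i, `|h' i| <= 1) ->
      doubled I k a u v y' h' <= doubled I k a u v y h].
Proof.
move=> N0 cu cv pu pv.
pose A (o : option I) : set E := if o is None then cube 0 N%:R else cube (-1) 1.
have cA : compact [set g : option I -> E | forall o, A o (g o)].
  by apply: (@tychonoff _ (fun=> E)) => -[i|]; exact: compact_cube.
pose F (g : option I -> E) := doubled I k a u v (g None) (fun i => g (Some i)).
have cF : continuous F.
  have cproj o : continuous (fun g : option I -> E => g o).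
    exact: (@proj_continuous _ (fun=> E)).
  have cu' i : continuous (fun g : option I -> E => u (g None - k i + g (Some i))).
    move=> g; apply: (@continuous_comp _ _ _
      (fun g : option I -> E => g None - k i + g (Some i)) u); last exact: cu.
    apply: (@continuousD _ _ _ (fun g : option I -> E => g None - k i)
      (fun g => g (Some i))); last exact: cproj.
    apply: (@continuousB _ _ _ (fun g : option I -> E => g None) (cst _)).
      exact: cproj.
    exact: cst_continuous.
  have cs i : continuous (fun g : option I -> E => a * sqnorm (g (Some i))).
    move=> g; apply: (@continuousM _ _ (cst a)
      (fun g : option I -> E => sqnorm (g (Some i)))); first exact: cst_continuous.
    apply: (@continuous_comp _ _ _ (fun g : option I -> E => g (Some i)) sqnorm).
      exact: cproj.
    exact: continuous_sqnorm.
  have cv' : continuous (fun g : option I -> E => #|I|%:R * v (g None)).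
    move=> g; apply: (@continuousM _ _ (cst _)
      (fun g : option I -> E => v (g None))); first exact: cst_continuous.
    apply: (@continuous_comp _ _ _ (fun g : option I -> E => g None) v).
      exact: cproj.
    exact: cv.
  move=> g; apply: (@continuousB _ _ _ (fun g : option I -> E =>
    \sum_i (u (g None - k i + g (Some i)) - a * sqnorm (g (Some i))))); last exact: cv'.
  move: g; apply: continuous_big => [|i _ g]; first exact: add_continuous.
  exact: (continuousB (cu' i g) (cs i g)).
have [|g gA gmax] := compact_EVT_max _ cA (continuous_subspaceT cF).
  exists (fun=> 0) => -[i|] j /=; rewrite mxE in_itv/= ?ler0n ?lexx//.
  by rewrite lerN10 ler01.
move: gA; rewrite inE /= => gA.
exists (g None), (fun i => g (Some i)); split.
- exact: gA None.
- by move=> i; apply/cubeP => //; exact: gA (Some i).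
move=> y' h' h1; have [l ly'] := lattice_reduction N y' N0.
have -> : doubled I k a u v y' h' =
    doubled I k a u v (y' + N%:R *: lattice_point l) h'.
  rewrite /doubled pv; congr (_ - _); apply: eq_bigr => i _.
  by rewrite -(pu l (y' - k i + h' i)) addrAC (addrAC y').
apply: (gmax (fun o => if o is Some i then h' i else y' + _)).
by rewrite inE => -[i|] //=; apply/cubeP.
Qed.

(** At a maximum of [doubled], varying one displacement alone gives the test for [u] at each point,
    and varying [y] with all these points frozen gives the test for [v]. *)
Lemma doubling (I : finType) (k : I -> E) (u v : E -> R) (N : nat) (eta : R) :
  (0 < #|I|)%N -> (0 < N)%N -> continuous u -> continuous v ->
  lattice_periodic N u -> lattice_periodic N v -> 0 < eta < 1 ->
  exists a y h, [/\ cube 0 N%:R y, forall i, `|h i| < eta,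
    forall i, let z := y - k i + h i in
      \forall x \near z, u x - paraboloid a (y - k i) x <=
                         u z - paraboloid a (y - k i) z &
    let m := y + #|I|%:R^-1 *: \sum_i h i in
      \forall x \near y, v y - paraboloid (- a) m y <=
                         v x - paraboloid (- a) m x].
Proof.
move=> I0 N0 cu cv pu pv /andP[eta0 eta1].
have [B uB] := periodic_bounded N u N0 cu pu.
have B0 : 0 <= B by apply: le_trans (uB 0).
(* Chosen so that [a * eta ^+ 2] exceeds [2 * B], a bound on the oscillation of [u]. *)
pose a := (2 * B + 1) / eta ^+ 2.
have a0 : 0 < a by rewrite divr_gt0 ?exprn_gt0//; lra.
have [y [h [yc h1 ymax]]] := doubled_max I k a u v N N0 cu cv pu pv.
have one i x : `|x| <= 1 ->
    u (y - k i + x) - a * sqnorm x <= u (y - k i + h i) - a * sqnorm (h i).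
  move=> x1.
  have := ymax y (fun j => if j == i then x else h j).
  rewrite /doubled lerD2r => /(_ _)/wrap[]; first by move=> j; case: ifP.
  rewrite (bigD1 i)//= [leRHS](bigD1 i)//= eqxx.
  rewrite (eq_bigr (fun j => u (y - k j + h j) - a * sqnorm (h j))) ?lerD2r//.
  by move=> j /negPf ->.
(* Comparison with zero displacement gives [a * sqnorm (h i) <= 2 * B], which is less than
   [a * eta ^+ 2]. *)
have heta i : `|h i| < eta.
  have := one i 0; rewrite normr0 ler01 sqnorm0 mulr0 subr0 addr0 => /(_ isT) le.
  have := uB (y - k i); have := uB (y - k i + h i).
  rewrite !ler_norml => /andP[_ b1] /andP[b2 _].
  have : a * sqnorm (h i) < a * eta ^+ 2.
    by rewrite [ltRHS]divfK ?expf_neq0 ?gt_eqF//; lra.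
  rewrite ltr_pM2l// => lt.
  rewrite -(ltr_pXn2r (ltn0Sn 1)) ?nnegrE ?(ltW eta0)//.
  exact: le_lt_trans (sqnorm_ge_norm _) lt.
exists a, y, h; split=> // [i z|m].
  (* This radius keeps the displacement [x - (y - k i)] in the unit ball, where maximality
     applies. *)
  have : \forall x \near z, `|z - x| < 1 - `|h i|.
    by apply: near_dist_lt; rewrite subr_gt0 (lt_trans (heta i)).
  apply: filterS => x zx.
  have := one i (x - (y - k i)); rewrite /paraboloid.
  have -> : z - (y - k i) = h i by rewrite /z addrC addKr.
  rewrite subrKC; apply.
  have -> : x - (y - k i) = h i - (z - x).
    by rewrite /z; apply/rowP => j; rewrite !mxE; ring.
  by have := ler_normB (h i) (z - x); lra.
have : \forall x \near y, `|y - x| < 1 - eta.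
  by apply: near_dist_lt; rewrite subr_gt0.
apply: filterS => x yx.
(* When [y] moves to [x], the displacements compensate: every argument of [u] stays fixed, and only
   the penalty and [v] change. *)
have := ymax x (fun i => h i + (y - x)).
pose w i := y + h i.
have n0 : 0 < #|I|%:R :> R by rewrite ltr0n.
have mE : m = #|I|%:R^-1 *: \sum_i w i.
  rewrite big_split/= scalerDr sumr_const -[y *+ _]scaler_nat scalerA.
  by rewrite mulVf ?gt_eqF// scale1r.
have bary x' : \sum_i sqnorm (w i - x') = #|I|%:R * sqnorm (x' - m) +
    (\sum_i sqnorm (w i) - #|I|%:R * sqnorm m).
  by rewrite mE; exact: sum_sqnorm_barycenter.
rewrite /doubled !sumrB -!mulr_sumr.
have -> : \sum_i u (x - k i + (h i + (y - x))) = \sum_i u (y - k i + h i).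
  apply: eq_bigr => i _; congr u.
  by apply/rowP => j; rewrite !mxE; ring.
have -> : \sum_i sqnorm (h i + (y - x)) = \sum_i sqnorm (w i - x).
  by apply: eq_bigr => i _; rewrite /w addrC addrAC.
have -> : \sum_i sqnorm (h i) = \sum_i sqnorm (w i - y).
  by apply: eq_bigr => i _; rewrite /w addrC addKr.
rewrite !bary /paraboloid => /(_ _)/wrap[].
  by move=> i; have := ler_normD (h i) (y - x); have := heta i; lra.
set c := _ - #|I|%:R * sqnorm m => le.
rewrite -(ler_pM2l n0); move: le; lra.
Qed.

End Doubling.

(** * Comparison of an averaged subsolution with a supersolution *)

Section Comparison.
Context {R : realType} {d : nat}.
Local Notation E := 'rV[R]_d.

Lemma superlinear_coercive (H : E -> E -> R) (A : R) : superlinear H ->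
  exists2 r, 0 <= r & forall p x, H p x <= A -> `|p| <= r.
Proof.
(* The maximum with [1] ensures that [(|A| + 1) * |p|] is at least [|A| + 1] beyond the radius. *)
move=> /(_ (`|A| + 1))[r [r0 Hr]]; exists (Num.max r 1) => [|p x HA].
  by rewrite le_max (ltW r0).
rewrite leNgt gt_max; apply/negP => /andP[rp p1].
have := Hr p x (ltW rp); have p0 : 0 < `|p| by exact: lt_trans p1.
rewrite mulrC ler_pdivlMr// => le.
have : `|A| + 1 <= (`|A| + 1) * `|p|.
  by rewrite ler_peMr// ?ltW//; have := normr_ge0 A; lra.
by have := ler_norm A; lra.
Qed.

(** Continuity at each [(z, 0)] and compactness of [K] give a common [eta]; the shifted point itself
    may leave [K]. *)
Lemma uniform_shift (G : E * E -> R) (K : set (E * E)) (delta : R) :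
  continuous G -> compact K -> 0 < delta ->
  exists2 eta, 0 < eta & forall h, `|h| < eta ->
    forall z, K z -> G z <= G (z.1, z.2 + h) + delta.
Proof.
move=> cG /compact_near_coveringP cK delta0.
have /nbhs_ballP[eta eta0 He] : \forall h \near (0 : E),
    K `<=` (fun z => G z <= G (z.1, z.2 + h) + delta).
  apply: (cK E (nbhs (0 : E)) (fun h z => G z <= G (z.1, z.2 + h) + delta)).
  move=> z _.
  pose F (zh : (E * E) * E) := G zh.1 - G (zh.1.1, zh.1.2 + zh.2).
  have cF : F x @[x --> (z, 0 : E)] --> (0 : R).
    have -> : (0 : R) = F (z, 0).
      by rewrite /F/= addr0 -surjective_pairing subrr.
    have c1 : continuous (fun zh : (E * E) * E => G zh.1).
      by move=> w; apply: continuous_comp; [exact: cvg_fst|exact: cG].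
    have c2 : continuous (fun zh : (E * E) * E => G (zh.1.1, zh.1.2 + zh.2)).
      have c11 : continuous (fun zh : (E * E) * E => zh.1.1).
        by move=> w; apply: (@continuous_comp _ _ _ fst fst); exact: cvg_fst.
      have c12 : continuous (fun zh : (E * E) * E => zh.1.2).
        move=> w; apply: (@continuous_comp _ _ _ fst snd); first exact: cvg_fst.
        exact: cvg_snd.
      have c3 : continuous (fun zh : (E * E) * E => zh.1.2 + zh.2).
        by move=> w; apply: (continuousD (c12 w)); exact: cvg_snd.
      move=> w; apply: (@continuous_comp _ _ _
        (fun zh : (E * E) * E => (zh.1.1, zh.1.2 + zh.2)) G); last exact: cG.
      exact: (cvg_pair (c11 w) (c3 w)).
    exact: (continuousB (c1 _) (c2 _)).
  have : \forall x \near (z, 0 : E), F x < delta by apply: (cvgr_lt _ cF).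
  by apply: filterS => -[z' h]; rewrite /F/= => lt; lra.
exists eta => // h heta z Kz; apply: He => //.
by rewrite -ball_normE /ball_/= sub0r normrN.
Qed.

(** Coercivity bounds the test gradients by a radius [r] depending only on [H] and [A], not on the
    penalty. Hence [eta] can be fixed from [r] and [delta] first, and the penalty chosen afterwards,
    with no limit to pass to. *)
Lemma effective_comparison (H : E -> E -> R) (f : E -> R) (c A : R) (N : nat)
    (I : finType) (k : I -> 'rV[int]_d) (u v : E -> R) (delta : R) :
  C2 (fun z : E * E => H z.1 z.2) -> (forall p, lattice_periodic 1 (H p)) ->
  (forall p x, positive_definite (hessian (fun q => H q x) p)) ->
  superlinear H -> (0 < N)%N -> (0 < #|I|)%N ->
  continuous u -> continuous v ->
  lattice_periodic N u -> lattice_periodic N v ->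
  (forall x, f x <= A) ->
  viscosity_subsolution (fun p x => H p x - f x) u ->
  viscosity_supersolution (fun p x => H p x - c) v ->
  0 < delta ->
  exists y h, (forall i, `|h i| <= 1) /\
    #|I|%:R * c <=
      \sum_i f (y - lattice_point (k i) + h i) + #|I|%:R * delta.
Proof.
move=> HC2 Hper Hpd Hsup N0 I0 cu cv pu pv fA subu supv delta0.
have [r r0 Hr] := superlinear_coercive H A Hsup.
have cG : continuous (fun z : E * E => H z.1 z.2).
  by move=> z; apply: differentiable_continuous; exact: HC2.1.1.
have [eta0 eta0_gt0 Heta] := uniform_shift _ _ _ cG
  (compact_setX (@compact_cube R d (- r) r) (@compact_cube R d 0 N%:R)) delta0.
pose eta := Num.min eta0 2^-1.
have eta01 : 0 < eta < 1.
  by rewrite lt_min eta0_gt0 gt_min /=; apply/andP; split; [lra|apply/orP; right; lra].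
have [a [y [h [yc hs ux vy]]]] :=
  doubling I (fun i => lattice_point (k i)) u v N eta I0 N0 cu cv pu pv eta01.
exists y, h; split.
  by move=> i; have /andP[_ e1] := eta01; exact: ltW (lt_trans (hs i) e1).
pose p i := (a *+ 2) *: h i; pose z i := y - lattice_point (k i) + h i.
have Hz i : H (p i) (z i) <= f (z i).
  have := subu _ (z i) (C1_paraboloid a (y - lattice_point (k i))) (ux i).
  rewrite grad_paraboloid subr_le0.
  by have -> : z i - (y - lattice_point (k i)) = h i by rewrite /z addrC addKr.
(* Integer periodicity replaces [z i] by [y + h i], and moving from there to [y] costs at most
   [delta]. This brings all the inequalities to the same point [y]. *)
have Hy i : H (p i) y <= f (z i) + delta.
  apply: le_trans (_ : H (p i) (y + h i) + delta <= _); last first.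
    rewrite lerD2r -(Hper _ (- k i)) scale1r.
    suff -> : y + h i + lattice_point (- k i) = z i by [].
    by rewrite /z /lattice_point map_mxN addrAC.
  apply: (Heta (h i) _ (p i, y)).
    by apply: lt_le_trans (hs i) _; rewrite ge_min lexx.
  by split=> //=; apply/cubeP => //; apply: Hr (le_trans (Hz i) (fA _)).
(* The paraboloid touching [v] has gradient [- 2 a (y - m)] at [y], which is the mean of the [p i]
   since [m - y] is the mean of the [h i]. *)
have Hc : c <= H (#|I|%:R^-1 *: \sum_i p i) y.
  have := supv _ y (C1_paraboloid _ _) vy; rewrite grad_paraboloid subr_ge0.
  rewrite opprD addNKr mulNrn scaleNr scalerN opprK.
  by rewrite -scaler_sumr !scalerA [a *+ 2 * _]mulrC.
rewrite -(ler_pM2l (_ : 0 < #|I|%:R)) ?ltr0n// in Hc.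
apply: (le_trans Hc); apply: (le_trans (jensen_hamiltonian H y I p HC2 _ I0)) => //.
apply: (le_trans (ler_sum _ (fun i _ => Hy i))).
by rewrite big_split/= sumr_const mulr_natl.
Qed.

End Comparison.

(** * Counting lattice points and bounding the periodized bump *)

Section Counting.
Context {R : realType} {d : nat}.
Local Notation E := 'rV[R]_d.

(** The support of [F] lies in the image of [P] under [g]; once repetitions are removed, at most
    [#|P|] terms remain. *)
Lemma fsum_le_card (T : choiceType) (J : finType) (P : pred J) (g : J -> T)
    (F : T -> R) (Z : R) : 0 <= Z -> (forall t, F t <= Z) ->
  (forall t, F t != 0 -> exists2 j, P j & g j = t) ->
  \sum_(t \in [set: T]) F t <= #|P|%:R * Z.
Proof.
move=> Z0 FZ Fg; pose r := undup [seq g j | j <- enum P].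
rewrite -(fsbig_widen [set` r] setT)//; last first.
  move=> t [_ /= tr]; apply/eqP; apply: contrapT => /negP /Fg[j Pj gj].
  apply: tr; rewrite mem_undup -gj; apply: map_f.
  by rewrite mem_enum.
rewrite -fsbig_seq ?undup_uniq//.
apply: (@le_trans _ _ (\sum_(t <- r) Z)); first exact: ler_sum.
rewrite big_const_seq count_predT iter_addr_0 -[Z *+ _]mulr_natl ler_wpM2r// ler_nat.
by rewrite (leq_trans (size_undup _))// size_map cardE.
Qed.

(** Each coordinate of [m] lies between [floor (y 0 l) - s] and [floor (y 0 l) + s], which leaves
    [2 s + 1] values. *)
Lemma lattice_points_near (s : nat) (y : E) (m : 'rV[int]_d) :
  `|y - lattice_point m| <= s%:R ->
  exists f : {ffun 'I_d -> 'I_(s.*2.+1)},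
    forall l, m 0 l = Num.floor (y 0 l) - s%:Z + (f l)%:Z.
Proof.
move=> /cubeP - /(_ (ler0n _ _)) cm.
pose g l := m 0 l - (Num.floor (y 0 l) - s%:Z).
have g0 l : 0 <= g l < (s.*2.+1)%:Z.
  have := cm l; rewrite /= in_itv/= !mxE => /andP[h1 h2].
  have /andP[h3 h4] := floor_itv (y 0 l).
  have : (Num.floor (y 0 l))%:~R < (m 0 l + s%:Z + 1)%:~R :> R.
    by rewrite !intrD; lra.
  have : (m 0 l)%:~R < (Num.floor (y 0 l) + s%:Z + 1)%:~R :> R.
    by rewrite !intrD; move: h4; rewrite intrD; lra.
  by rewrite !ltr_int /g => ? ?; apply/andP; split; lia.
exists [ffun l => inord `|g l|%N] => l; rewrite ffunE inordK.
  by have /andP[gl0 _] := g0 l; rewrite gez0_abs// /g addrC subrK.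
have /andP[gl0 gl1] := g0 l.
by rewrite -ltz_nat gez0_abs.
Qed.

Definition residue_shift (N : nat) (i : {ffun 'I_d -> 'I_N}) : 'rV[int]_d :=
  \row_l (i l)%:Z.

(* Every lattice point is [k + N j] for exactly one residue [k] and one [j], so
   the double sum counts each lattice point near [y] at most once. *)
Lemma sum_periodized_le (zeta : E -> R) (s : nat) (Z : R) (N : nat) (y : E)
    (h : {ffun 'I_d -> 'I_N} -> E) :
  (0 < N)%N -> 0 <= Z -> (forall x, zeta x <= Z) ->
  (forall x, zeta x != 0 -> `|x| <= s%:R) -> (forall i, `|h i| <= 1) ->
  \sum_i periodized zeta N (y - lattice_point (residue_shift N i) + h i) <=
    ((s.+1.*2.+1) ^ d)%:R * Z.
Proof.
move=> N0 Z0 zZ zs h1.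
have NZ : N%:Z != 0 by rewrite eqz_nat -lt0n.
pose J := {ffun 'I_d -> 'I_(s.+1.*2.+1)}.
pose m (f : J) l := Num.floor (y 0 l) - s.+1%:Z + (f l)%:Z.
(* [J] enumerates the candidate lattice points near [y], and [P i] selects those in the residue
   class of [i] modulo [N]. *)
pose P i (f : J) := [forall l, (m f l == (i : {ffun 'I_d -> 'I_N}) l %[mod N])%Z].
have le1 i : periodized zeta N (y - lattice_point (residue_shift N i) + h i) <=
    #|P i|%:R * Z.
  apply: (fsum_le_card _ _ _ (fun f : J => \row_l ((m f l - (i l)%:Z) %/ N)%Z)) => // j.
  move=> /zs; set x := y - _ + _ - _ => xs.
  (* The radius grows from [s] to [s.+1] to absorb the displacement [h i]. *)
  have : `|y - lattice_point (residue_shift N i + N%:Z *: j)| <= s.+1%:R.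
    have -> : y - lattice_point (residue_shift N i + N%:Z *: j) = x - h i.
      by apply/rowP => l; rewrite !mxE intrD intrM; ring.
    by rewrite (le_trans (ler_normB _ _))// -natr1 lerD.
  move=> /lattice_points_near[f fE].
  have mE l : m f l = (i l)%:Z + N%:Z * j 0 l by rewrite /m -fE !mxE.
  exists f.
    by apply/forallP => l; rewrite mE addrC [_ * j _ _]mulrC modzMDl.
  by apply/rowP => l; rewrite mxE mE addrC addKr mulKz.
apply: (le_trans (ler_sum _ (fun i _ => le1 i))).
rewrite -mulr_suml ler_wpM2r// -natr_sum ler_nat.
have -> : ((s.+1.*2.+1) ^ d)%N = (\sum_(f : J) 1)%N.
  by rewrite sum1_card card_ffun !card_ord.
under eq_bigr do rewrite -sum1_card.
(* After the exchange, each candidate [f] contributes at most one residue, since residues below [N]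
   that are congruent modulo [N] coincide. *)
rewrite (exchange_big_dep predT)//=; apply: leq_sum => f _.
rewrite sum1_card; apply/card_le1_eqP => i i' /forallP Pi /forallP Pi'.
apply/ffunP => l; apply: val_inj => /=.
have : ((i l)%:Z = (i' l)%:Z %[mod N])%Z by rewrite -(eqP (Pi l)) (eqP (Pi' l)).
by rewrite !modz_nat !modn_small// => -[].
Qed.

Lemma periodized_ge0 (zeta : E -> R) (N : nat) (x : E) :
  (forall x, 0 <= zeta x) -> 0 <= periodized zeta N x.
Proof. by move=> z0; apply: sumr_ge0. Qed.

Lemma periodized_bounded (zeta : E -> R) (s : nat) (Z : R) (N : nat) (x : E) :
  (0 < N)%N -> (forall x, 0 <= zeta x <= Z) ->
  (forall x, zeta x != 0 -> `|x| <= s%:R) ->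
  periodized zeta N x <= ((s.+1.*2.+1) ^ d)%:R * Z.
Proof.
move=> N0 zZ zs.
have z0 x' : 0 <= zeta x' by case/andP: (zZ x').
have Z0 : 0 <= Z by case/andP: (zZ 0); exact: le_trans.
apply: le_trans (sum_periodized_le _ _ _ _ x (fun=> 0) N0 Z0 _ zs _); last 2 first.
- by move=> x'; case/andP: (zZ x').
- by move=> i; rewrite normr0 ler01.
(* The term of residue zero is the quantity to bound, and the other terms are nonnegative. *)
rewrite (bigD1 [ffun => Ordinal N0])//=.
have -> : lattice_point (residue_shift N [ffun => Ordinal N0]) = 0 :> E.
  by apply/rowP => l; rewrite !mxE ffunE.
by rewrite subr0 addr0 lerDl sumr_ge0// => i _; exact: periodized_ge0.
Qed.

(** These two numbers carry all the dependence of the final constant on [zeta]. *)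
Lemma lipschitz_compact_support_bounds (zeta : E -> R) :
  lipschitz zeta -> compactly_supported zeta ->
  exists (s : nat) (Z : R), 0 <= Z /\
   (forall x, zeta x <= Z) /\ (forall x, zeta x != 0 -> `|x| <= s%:R).
Proof.
move=> [L [_ lip]] /compact_bounded[M [_ bM]].
pose s := (Num.truncn (M + 1)).+1.
have zs x : zeta x != 0 -> `|x| <= s%:R.
  move=> zx; apply: (@le_trans _ _ (M + 1)); last by rewrite ltW// truncnS_gt.
  by apply: (bM (M + 1)); [rewrite ltrDl|exact: subset_closure].
exists s, (`|zeta 0| + (`|L| + 1) * s%:R); split; [|split=> //].
  by rewrite addr_ge0// mulr_ge0// addr_ge0.
move=> x; have [->|/zs xs] := eqVneq (zeta x) 0.
  by rewrite addr_ge0// mulr_ge0// addr_ge0.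
have := lip (`|L| + 1) _ (x, 0) (conj I I); rewrite /= subr0.
move=> /(_ _)/wrap[]; first by have := ler_norm L; lra.
have := ler_norm (zeta x - zeta 0); have := ler_norm (zeta 0).
have : (`|L| + 1) * `|x| <= (`|L| + 1) * s%:R by rewrite ler_wpM2l// addr_ge0.
lra.
Qed.

End Counting.

(** * The two bounds on the difference of effective constants *)

Theorem corollary3p2 (R : realType) (d : nat) (d_gt0 : (0 < d)%N)
    (zeta : 'rV[R]_d -> R)
    (zeta_ge0 : forall x, 0 <= zeta x)
    (zeta_lipschitz : lipschitz zeta)
    (zeta_compact : compactly_supported zeta) :
  exists C : R, 0 < C /\
    forall H : 'rV[R]_d -> 'rV[R]_d -> R,
      C2 (fun z : 'rV[R]_d * 'rV[R]_d => H z.1 z.2) ->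
      (forall p, lattice_periodic 1 (H p)) ->
      (forall p x, positive_definite (hessian (fun q => H q x) p)) ->
      superlinear H ->
    forall Hbar : R, effective_constant H 1 Hbar ->
    forall (N : nat) (HbarN : R), (0 < N)%N ->
      effective_constant (perturbed H zeta N) N HbarN ->
      0 <= Hbar - HbarN <= C * N%:R ^- d.
Proof.
have [s [Z [Z0 [zZ zs]]]] :=
  lipschitz_compact_support_bounds zeta zeta_lipschitz zeta_compact.
pose C := ((s.+1.*2.+1) ^ d)%:R * Z.
have C0 : 0 <= C by rewrite mulr_ge0.
(* [C] may be zero, hence the added [1]. *)
exists (C + 1); split=> [|H HC2 Hper Hpd Hsup Hbar]; first by rewrite ltr_wpDl.
move=> [chi [cchi pchi [subchi superchi]]] N HbarN N0.
move=> [chiN [cchiN pchiN [subchiN superchiN]]].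
have pchi' : lattice_periodic N chi.
  move=> k x; rewrite -[in RHS](pchi (N%:Z *: k) x) scale1r; congr (chi (_ + _)).
  by apply/rowP => i; rewrite !mxE intrM.
have zN0 x : 0 <= periodized zeta N x by exact: periodized_ge0.
apply/andP; split.
  rewrite subr_ge0; apply/ler_addgt0Pr => delta delta0.
  (* A single translate: since the bump is nonnegative, [chiN] is a supersolution for [H] with
     right-hand side [HbarN], and it is compared with [chi]. *)
  have [||y [h [_]]] := effective_comparison H (cst Hbar) HbarN Hbar N unit
    (fun=> 0) chi chiN delta HC2 Hper Hpd Hsup N0 _ cchi cchiN pchi' pchiN
    (fun=> lexx _) subchi _ delta0.
  - by rewrite card_unit.
  - move=> phi x phi1 /(superchiN _ _ phi1); rewrite /perturbed.
    by have := zN0 x; lra.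
  - by rewrite card_unit !mul1r sumr_const card_unit.
(* This pointwise bound only serves to bound the gradients; the factor [N%:R ^- d] comes from the
   sum over all residues. *)
have NC x : periodized zeta N x <= C.
  by apply: periodized_bounded => // x'; rewrite zeta_ge0 zZ.
have Nd0 : 0 < N%:R ^+ d :> R by rewrite exprn_gt0// ltr0n.
have cardI : #|{ffun 'I_d -> 'I_N}|%:R = N%:R ^+ d :> R.
  by rewrite card_ffun !card_ord natrX.
apply/ler_addgt0Pr => delta delta0.
(* Now the roles are exchanged: all [N ^ d] translates of [chiN] are compared with [chi], and the
   periodized terms sum to at most [C]. *)
have [|||y [h [h1]]] := effective_comparison H
  (fun x => HbarN + periodized zeta N x) Hbar (HbarN + C) N
  {ffun 'I_d -> 'I_N} (residue_shift N) chiN chi delta HC2 Hper Hpd Hsup N0 _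
  cchiN cchi pchiN pchi' _ _ superchi delta0.
- by rewrite -(ltr0n R) cardI.
- by move=> x; rewrite lerD2l.
- move=> phi x phi1 /(subchiN _ _ phi1); rewrite /perturbed.
  by lra.
have := sum_periodized_le zeta s Z N y h N0 Z0 zZ zs h1; rewrite -/C => le.
rewrite big_split/= sumr_const -[HbarN *+ _]mulr_natl cardI => le2.
rewrite -(ler_pM2r Nd0) [leRHS]mulrDl divfK ?gt_eqF//.
by move: le le2; lra.
Qed.
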